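(* Let $n,k,d\ge 1$ be integers, let $\mathbf{z}_1,\dots,\mathbf{z}_n\in\mathbb{R}^d$ and let $\mathbf{u}_1,\dots,\mathbf{u}_k\in\mathbb{R}^d$ be fixed. Let $\mathbf{P}^*\in\mathcal{B}(n,k)$ be an optimal transport plan from $\mu=\frac1n\sum_{i=1}^n\delta_{\mathbf{z}_i}$ to $\nu=\frac1k\sum_{j=1}^k\delta_{\mathbf{u}_j}$ for the squared $L_2$ cost, i.e. a minimizer over $\mathbf{P}\in\mathcal{B}(n,k)$ of $$\sum_{i=1}^n\sum_{j=1}^k\|\mathbf{z}_i-\mathbf{u}_j\|_2^2\,P_{ij}.$$ Then the barycentric map $T_{\mathbf{P}^*}$, given by $$T_{\mathbf{P}^*}(\mathbf{z}_i)=n\sum_{j=1}^kP^*_{ij}\mathbf{u}_j,\qquad i=1,\dots,n,$$ has a cyclically monotone graph; that is, the set $\{(\mathbf{z}_i,\,n\sum_{j=1}^kP^*_{ij}\mathbf{u}_j): i=1,\dots,n\}\subseteq\mathbb{R}^d\times\mathbb{R}^d$ is cyclically monotone.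
   Context: $\mathcal{B}(n,k)$ is the set of matrices $\mathbf{P}\in\mathbb{R}^{n\times k}$ with nonnegative entries such that every row sums to $1/n$ and every column sums to $1/k$. A set $\Gamma\subseteq\mathbb{R}^d\times\mathbb{R}^d$ is cyclically monotone if for every $m\in\mathbb{N}$ and every family $(\mathbf{x}_1,\mathbf{y}_1),\dots,(\mathbf{x}_m,\mathbf{y}_m)\in\Gamma$ (with the convention $\mathbf{y}_{m+1}=\mathbf{y}_1$) one has $$-\sum_{i=1}^m\langle\mathbf{x}_i,\mathbf{y}_i\rangle\le-\sum_{i=1}^m\langle\mathbf{x}_i,\mathbf{y}_{i+1}\rangle.$$ *)

(* Defs.v *)
From mathcomp Require Import all_boot all_order all_algebra.
From mathcomp Require Import classical_sets reals.

Set Implicit Arguments.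
Unset Strict Implicit.
Unset Printing Implicit Defensive.

Import Order.TTheory GRing.Theory Num.Theory.
Local Open Scope classical_set_scope.
Local Open Scope ring_scope.

Section TransportDefs.
Variable R : realType.

Definition inner d (x y : 'rV[R]_d) : R := \sum_(l < d) x 0 l * y 0 l.

(* The norm MathComp-Analysis puts on 'rV[R]_d is the sup norm, hence a
   separate Euclidean norm. *)
Definition l2norm d (x : 'rV[R]_d) : R := Num.sqrt (inner x x).

(* The set B(n, k): couplings of the uniform weights on n and k points. *)
Definition couplings n k : set 'M[R]_(n, k) :=
  [set P : 'M[R]_(n, k) |
    [/\ forall i j, 0 <= P i j,
        forall i, \sum_(j < k) P i j = 1 / n%:R &
        forall j, \sum_(i < n) P i j = 1 / k%:R]].

Definition transport_cost n k d (z : 'I_n -> 'rV[R]_d) (u : 'I_k -> 'rV[R]_d)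
    (P : 'M[R]_(n, k)) : R :=
  \sum_(i < n) \sum_(j < k) l2norm (z i - u j) ^+ 2 * P i j.

Definition optimal_plan n k d (z : 'I_n -> 'rV[R]_d) (u : 'I_k -> 'rV[R]_d)
    (P : 'M[R]_(n, k)) : Prop :=
  couplings P /\
  forall Q : 'M[R]_(n, k), couplings Q ->
    transport_cost z u P <= transport_cost z u Q.

(* Indexed by i rather than by the point z_i: the z_i need not be distinct. *)
Definition barycentric_map n k d (u : 'I_k -> 'rV[R]_d) (P : 'M[R]_(n, k))
    (i : 'I_n) : 'rV[R]_d :=
  n%:R *: \sum_(j < k) P i j *: u j.

Definition barycentric_graph n k d (z : 'I_n -> 'rV[R]_d)
    (u : 'I_k -> 'rV[R]_d) (P : 'M[R]_(n, k)) : set ('rV[R]_d * 'rV[R]_d) :=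
  range (fun i : 'I_n => (z i, barycentric_map u P i)).

(* ordS is the successor modulo m, i.e. the convention y_(m+1) = y_1. *)
Definition cyclically_monotone d (G : set ('rV[R]_d * 'rV[R]_d)) : Prop :=
  forall (m : nat) (x y : 'I_m -> 'rV[R]_d),
    (forall i, G (x i, y i)) ->
    - \sum_(i < m) inner (x i) (y i) <= - \sum_(i < m) inner (x i) (y (ordS i)).

End TransportDefs.

(* Main.v *)
Require Import Defs.
From mathcomp Require Import all_boot all_order all_algebra.
From mathcomp Require Import classical_sets reals.
From mathcomp Require Import ring lra.

(** Expanding the squares, the cost of a coupling [P] is a constant minus
    [2 / n] times the correlation [\sum_i <z_i, T_P z_i>], so an optimal plan
    maximizes the correlation.  Given points [z_(s 1), ..., z_(s m)], replace a
    fraction [1 / m] of row [s t] of [P] by the same fraction of row [s (t + 1)],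
    for all [t] simultaneously.  The result is again a coupling, and since
    [T_P] is linear in [P], comparing correlations gives the cyclic inequality
    for the barycentric map directly. *)

Set Implicit Arguments.
Unset Strict Implicit.
Unset Printing Implicit Defensive.

Import Order.TTheory GRing.Theory Num.Theory.
Local Open Scope ring_scope.

Section Inner.
Variables (R : realType) (d : nat).
Implicit Types x y : 'rV[R]_d.

Lemma innerDr x y y' : inner x (y + y') = inner x y + inner x y'.
Proof.
by rewrite /inner -big_split; apply: eq_bigr => l _; rewrite mxE mulrDr.
Qed.

Lemma innerZr a x y : inner x (a *: y) = a * inner x y.
Proof.
by rewrite /inner mulr_sumr; apply: eq_bigr => l _; rewrite mxE mulrCA.
Qed.

Lemma inner_sumr (I : finType) x (F : I -> 'rV[R]_d) :
  inner x (\sum_i F i) = \sum_i inner x (F i).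
Proof.
rewrite /inner exchange_big; apply: eq_bigr => l _.
by rewrite summxE mulr_sumr.
Qed.

Lemma sqr_l2norm x : l2norm x ^+ 2 = inner x x.
Proof.
by rewrite sqr_sqrtr //; apply: sumr_ge0 => l _; rewrite -expr2 sqr_ge0.
Qed.

Lemma sqr_l2normB x y :
  l2norm (x - y) ^+ 2 = inner x x + inner y y - 2 * inner x y.
Proof.
rewrite sqr_l2norm /inner mulr_sumr -big_split -sumrB.
by apply: eq_bigr => l _; rewrite !mxE /=; ring.
Qed.

End Inner.

Section Transport.
Variables (R : realType) (n k d : nat).
Variables (z : 'I_n -> 'rV[R]_d) (u : 'I_k -> 'rV[R]_d).
Implicit Types P Q : 'M[R]_(n, k).

Lemma inner_barycentric_map x P i :
  inner x (barycentric_map u P i) = n%:R * \sum_j P i j * inner x (u j).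
Proof.
rewrite innerZr inner_sumr; congr (_ * _).
by apply: eq_bigr => j _; rewrite innerZr.
Qed.

(** The marginals of [P] turn the two quadratic terms into constants, leaving only the cross term
    dependent on [P]. *)
Lemma transport_cost_coupling P : couplings P ->
  transport_cost z u P =
    \sum_i inner (z i) (z i) / n%:R + \sum_j inner (u j) (u j) / k%:R
    - 2 * \sum_i \sum_j P i j * inner (z i) (u j).
Proof.
case=> _ rowP colP.
have -> : \sum_j inner (u j) (u j) / k%:R
        = \sum_i \sum_j inner (u j) (u j) * P i j.
  rewrite exchange_big; apply: eq_bigr => j _.
  by rewrite -mulr_sumr colP mul1r.
rewrite mulr_sumr -big_split -sumrB; apply: eq_bigr => i _ /=.
have -> : inner (z i) (z i) / n%:R = \sum_j inner (z i) (z i) * P i j.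
  by rewrite -mulr_sumr rowP mul1r.
rewrite mulr_sumr -big_split -sumrB; apply: eq_bigr => j _ /=.
by rewrite sqr_l2normB; ring.
Qed.

Lemma optimal_plan_correlation P Q : optimal_plan z u P -> couplings Q ->
  \sum_i \sum_j Q i j * inner (z i) (u j)
    <= \sum_i \sum_j P i j * inner (z i) (u j).
Proof.
move=> [cP optP] cQ; have := optP Q cQ.
rewrite !transport_cost_coupling //; lra.
Qed.

End Transport.

Section RowShift.
Variables (R : realType) (n k m : nat).
Variables (s : 'I_m -> 'I_n) (f : 'I_m -> 'I_m).

(** Since [s] may repeat indices, the replacements affecting a row are added up over all [t] with
    [s t = i]. *)
Definition row_shift (P : 'M[R]_(n, k)) : 'M[R]_(n, k) :=
  \matrix_(i, j) (P i j
    + m%:R^-1 * \sum_t (s t == i)%:R * (P (s (f t)) j - P (s t) j)).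

Lemma sum_delta_row (F : 'I_n -> R) (a : 'I_n) :
  \sum_i (a == i)%:R * F i = F a.
Proof.
rewrite (bigD1 a) //= eqxx mul1r big1 ?addr0 // => i.
by rewrite eq_sym => /negbTE ->; rewrite mul0r.
Qed.

(** The weight [w] is free so as to serve twice: [w = 1] gives the column sums,
    [w i = inner (z i) (u j)] the correlation. *)
Lemma sum_row_shift (P : 'M[R]_(n, k)) (w : 'I_n -> R) j :
  \sum_i w i * row_shift P i j = \sum_i w i * P i j
    + m%:R^-1 * \sum_t w (s t) * (P (s (f t)) j - P (s t) j).
Proof.
under eq_bigr do rewrite mxE mulrDr.
rewrite big_split /=; congr (_ + _).
under eq_bigr do rewrite mulrCA mulr_sumr.
rewrite -mulr_sumr exchange_big; congr (_ * _); apply: eq_bigr => t _ /=.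
rewrite -(sum_delta_row w) mulr_suml.
by apply: eq_bigr => i _; ring.
Qed.

Hypothesis f_inj : injective f.

Lemma couplings_row_shift (P : 'M[R]_(n, k)) : (0 < m)%N ->
  couplings P -> couplings (row_shift P).
Proof.
move=> m_gt0 [P0 rowP colP].
have m0 : m%:R != 0 :> R by rewrite pnatr_eq0 -lt0n.
split=> [i j|i|j].
(* Splitting [P i j] into [m] equal shares makes each summand either [P i j] or [P (s (f t)) j],
   both nonnegative. *)
- have -> : row_shift P i j = m%:R^-1 *
      \sum_t (P i j + (s t == i)%:R * (P (s (f t)) j - P (s t) j)).
    by rewrite mxE big_split /= sumr_const card_ord -[P i j *+ m]mulr_natl
               mulrDr mulKf.
  rewrite mulr_ge0 ?invr_ge0 //; apply: sumr_ge0 => t _.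
  case: eqP => [->|_]; first by rewrite mul1r addrC subrK.
  by rewrite mul0r addr0.
- under eq_bigr do rewrite mxE.
  rewrite big_split /= rowP -mulr_sumr exchange_big big1 ?mulr0 ?addr0 // => t _.
  by rewrite -mulr_sumr sumrB !rowP subrr mulr0.
- under eq_bigr do rewrite -[row_shift _ _ _]mul1r.
  rewrite (sum_row_shift P (fun=> 1)) -2!mulr_sumr !mul1r colP sumrB.
  (* An injective [f] permutes the finite index set, so the mass added to a column equals the mass
     removed. *)
  by rewrite [X in _ - X](reindex_inj f_inj) subrr mulr0 addr0 mul1r.
Qed.

End RowShift.

Lemma barycentric_map_monotone (R : realType) (n k d m : nat)
    (z : 'I_n -> 'rV[R]_d) (u : 'I_k -> 'rV[R]_d) (P : 'M[R]_(n, k))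
    (s : 'I_m -> 'I_n) (f : 'I_m -> 'I_m) :
  optimal_plan z u P -> injective f ->
  \sum_t inner (z (s t)) (barycentric_map u P (s (f t)))
    <= \sum_t inner (z (s t)) (barycentric_map u P (s t)).
Proof.
move=> optP f_inj.
case: (posnP m) => [m0|m_gt0].
  by rewrite !big1 // => t; have := leq_ltn_trans (leq0n t) (ltn_ord t);
     rewrite [X in (_ < X)%N]m0.
rewrite -subr_le0 -sumrB.
under eq_bigr do rewrite !inner_barycentric_map -mulrBr -sumrB.
rewrite -mulr_sumr.
apply: mulr_ge0_le0; first exact: ler0n.
have := optimal_plan_correlation optP
          (couplings_row_shift s f_inj m_gt0 (proj1 optP)).
(* With the sum over [j] outermost, [sum_row_shift] applies column by column. *)
under eq_bigr do under eq_bigr do rewrite mulrC.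
rewrite exchange_big /=.
under eq_bigr do rewrite sum_row_shift.
rewrite big_split /= exchange_big /=.
under [X in X + _ <= _]eq_bigr do under eq_bigr do rewrite mulrC.
(* The correlation of [P] cancels, and the positive factor [m%:R^-1] drops from what remains. *)
rewrite gerDl -mulr_sumr pmulr_rle0 ?invr_gt0 ?ltr0n // exchange_big /=.
by under eq_bigr do under eq_bigr do rewrite mulrC mulrBl.
Qed.

Theorem theorem2 (R : realType) (n k d : nat)
    (hn : (1 <= n)%N) (hk : (1 <= k)%N) (hd : (1 <= d)%N)
    (z : 'I_n -> 'rV[R]_d) (u : 'I_k -> 'rV[R]_d)
    (Pstar : 'M[R]_(n, k)) (hP : optimal_plan z u Pstar) :
  cyclically_monotone (barycentric_graph z u Pstar).
Proof.
move=> m x y Gxy; rewrite lerN2.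
(* One index must yield both coordinates: [x t] alone does not determine it when the [z i]
   coincide. *)
have /fin_all_exists [s xyE] :
    forall t, exists i, z i = x t /\ barycentric_map u Pstar i = y t.
  by move=> t; have [i _ [<- <-]] := Gxy t; exists i.
have := barycentric_map_monotone s hP (@ordS_inj m).
under eq_bigr do rewrite (proj1 (xyE _)) (proj2 (xyE _)).
by under [X in _ <= X]eq_bigr do rewrite (proj1 (xyE _)) (proj2 (xyE _)).
Qed.
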